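(* Let $X\neq\{0\}$ be a complex Banach space with unit ball $B_X$ and let $n\ge 1$ be an integer. Let $a=(a_1,\dots,a_n)\in\overline{\mathbb{D}^n}$ and let $F:B_X\to\overline{\mathbb{D}^n}$ be a holomorphic mapping with $$F(z)=a+\sum_{s=1}^\infty P_s(z),\qquad z\in B_X,$$ where $P_s(z)=\frac{1}{s!}D^sF(0)(z^s)$. Assume that $|a_j|=\Vert a\Vert_\infty$ for all $j\in\{1,\dots,n\}$. Then $$\mathcal{F}_F(\Vert z\Vert):=\sum_{k=0}^\infty\Vert a\Vert_\infty\Vert z\Vert^k+\sum_{N=1}^\infty\left(\sum_{k=1}^N\Vert z\Vert^{k-1}\,\Vert P_{N-k+1}(z)\Vert_\infty\right)\le\frac1{1-r}$$ for all $z\in B_X$ with $\Vert z\Vert=r\le 1/3$. The number $1/3$ cannot be improved, i.e. for every $R'\in(1/3,1)$ there exist a mapping $F$ satisfying all the hypotheses above (for the same $X$ and $n$) and a point $z\in B_X$ with $\Vert z\Vert=r\le R'$ for which the inequality fails.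
   Context: $\mathbb{D}=\{z\in\mathbb{C}:|z|<1\}$; $\mathbb{D}^n$ is the open unit polydisc in $\mathbb{C}^n$ and $\overline{\mathbb{D}^n}$ its closure. $\Vert w\Vert_\infty=\max_{1\le j\le n}|w_j|$ for $w\in\mathbb{C}^n$. $B_X=\{x\in X:\Vert x\Vert<1\}$. $D^sF(0)$ is the $s$-th Fréchet derivative of $F$ at $0$, a symmetric $s$-linear mapping $X^s\to\mathbb{C}^n$, and $D^sF(0)(z^s)$ means $D^sF(0)(z,\dots,z)$; thus $P_s$ is the $s$-homogeneous polynomial in the expansion of $F$ at the origin. The quantity $\mathcal{F}_F(\Vert z\Vert)$ (the majorant series associated with the discrete Fourier transform) depends on $z$, not only on $\Vert z\Vert$, despite the notation. Convention: $0^0=1$. *)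

(* Defs.v *)
From HB Require Import structures.
From mathcomp Require Import all_boot all_order all_algebra.
From mathcomp Require Export complex.
From mathcomp Require Import all_classical all_reals all_analysis.

Set Implicit Arguments.
Unset Strict Implicit.
Unset Printing Implicit Defensive.

Import Order.TTheory GRing.Theory Num.Theory.
Import numFieldNormedType.Exports.

Local Open Scope classical_set_scope.
Local Open Scope ring_scope.

Lemma ReK (R : rcfType) (c : R[i]) : (complex.Re `|c|)%:C%C = `|c|.
Proof. by case: c. Qed.

(* The norms of normed modules over R[i] take values in R[i]; [rnorm] is the
   same norm as a real number.  On 'rV[R[i]]_n the norm is the maximum norm
   (see [mx_norm]). *)
Definition rnorm (R : realType) (V : normedModType R[i]) (x : V) : R :=
  complex.Re `|x|.

Section rnorm_theory.
Variables (R : realType) (V : normedModType R[i]).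
Implicit Types x y : V.

Lemma rnormE x : (rnorm x)%:C%C = `|x|.
Proof.
rewrite /rnorm; have := normr_ge0 x; rewrite lecE => /andP[/eqP /= h _].
by case: `|x| h => u v /= ->.
Qed.

Lemma rnorm_ge0 x : 0 <= rnorm x.
Proof. by rewrite -lecR rnormE normr_ge0. Qed.

Lemma rnormD x y : rnorm (x + y) <= rnorm x + rnorm y.
Proof. by rewrite -lecR rmorphD/= !rnormE ler_normD. Qed.

End rnorm_theory.

Lemma rnormZ (R : realType) (V : normedModType R[i]) (c : R[i]) (x : V) :
  rnorm (c *: x) = complex.Re `|c| * rnorm x.
Proof.
by apply: (@complexI R); rewrite rmorphM/= !rnormE normrZ ReK.
Qed.

Section continuous_linear_maps.
Variables (R : realType) (X Y : normedModType R[i]).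

Definition clin : {pred X -> Y} :=
  [pred f : X -> Y | `[< linear f /\ continuous f >]].

Lemma clinP (f : X -> Y) : reflect (linear f /\ continuous f) (f \in clin).
Proof. exact: asboolP. Qed.

Lemma clin_submod_closed : submod_closed clin.
Proof.
split=> [|c f g /clinP[lf cf] /clinP[lg cg]]; apply/clinP; split.
- by move=> k x y; rewrite /= scaler0 addr0.
- exact: cst_continuous.
- move=> k x y; rewrite !fctE lf lg scalerDr !scalerA mulrC scalerDr !scalerA.
  exact: addrACA.
- by move=> x; apply: cvgD; [apply: cvgZl_tmp; exact: cf|exact: cg].
Qed.

HB.instance Definition _ :=
  GRing.isSubmodClosed.Build R[i] (X -> Y) clin clin_submod_closed.

Record contlin := ContLin { contlin_fun :> X -> Y; _ : contlin_fun \in clin }.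

HB.instance Definition _ := [isSub for contlin_fun].
HB.instance Definition _ := [Choice of contlin by <:].
HB.instance Definition _ := [SubChoice_isSubLmodule of contlin by <:].

Lemma contlinP (f : contlin) : linear f /\ continuous f.
Proof. exact/clinP/(valP f). Qed.

Definition opnorm (f : contlin) : R :=
  sup [set rnorm (f x) | x in [set x : X | `|x| <= 1]].

Implicit Types f g : contlin.

Lemma opnorm_has_sup f :
  has_sup [set rnorm (f x) | x in [set x : X | `|x| <= 1]].
Proof.
have [lf cf] := contlinP f.
pose l := GRing.isLinear.Build _ _ _ _ (f : X -> Y) lf.
pose F : {linear X -> Y} := HB.pack (f : X -> Y) l.
split; first by exists (rnorm (f 0)), 0 => //=; rewrite normr0.
have /bounded_funP/(_ 1)[M hM] : bounded_near F (nbhs 0).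
  exact/linear_bounded_continuous.
exists (complex.Re M) => _ [x /= x1 <-].
by have := hM x x1; rewrite lecE => /andP[].
Qed.

Lemma opnorm_ub f x : `|x| <= 1 -> rnorm (f x) <= opnorm f.
Proof.
by move=> x1; apply: ub_le_sup; [case: (opnorm_has_sup f)|exists x].
Qed.

Lemma opnorm_le f M :
  (forall x, `|x| <= 1 -> rnorm (f x) <= M) -> opnorm f <= M.
Proof.
move=> h; apply: ge_sup; first by case: (opnorm_has_sup f).
by move=> _ [x x1 <-]; exact: h.
Qed.

Lemma opnorm_ge0 f : 0 <= opnorm f.
Proof.
by apply: le_trans (rnorm_ge0 (f 0)) _; apply: opnorm_ub; rewrite normr0.
Qed.

Lemma ler_opnormD f g :
  (opnorm (f + g))%:C%C <= (opnorm f)%:C%C + (opnorm g)%:C%C :> R[i].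
Proof.
rewrite -rmorphD lecR; apply: opnorm_le => x x1.
apply: (le_trans (rnormD (f x) (g x))).
by apply: lerD; exact: opnorm_ub.
Qed.

Lemma opnorm_eq0 f : (opnorm f)%:C%C = 0 :> R[i] -> f = 0.
Proof.
move=> [f0]; have [lf _] := contlinP f.
apply/val_inj/funext => x /=; apply/eqP; rewrite -normr_eq0.
have [->|x0] := eqVneq x 0.
  by have := lf (-1) 0 0; rewrite scaler0 addr0 scaleN1r addNr => ->; rewrite normr0.
have nx0 : `|x| != 0 by rewrite normr_eq0.
have := @opnorm_ub f (`|x|^-1 *: x).
rewrite normrZ normfV normr_id mulVf// lexx => /(_ isT).
have := lf `|x|^-1 x 0; rewrite addr0.
have -> : f 0 = 0 by have := lf (-1) 0 0; rewrite scaler0 addr0 scaleN1r addNr.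
rewrite addr0 => ->; rewrite f0 -lecR rnormE normrZ normfV normr_id.
by rewrite pmulr_rle0 ?invr_gt0 ?normr_gt0// normr_le0 => /eqP ->; rewrite normr0.
Qed.

Lemma opnormZ (c : R[i]) f :
  (opnorm (c *: f))%:C%C = `|c| * (opnorm f)%:C%C.
Proof.
rewrite -(ReK c) -rmorphM; congr (_%:C)%C.
have hle (d : R[i]) g : opnorm (d *: g) <= complex.Re `|d| * opnorm g.
  apply: opnorm_le => x x1; rewrite [X in rnorm X](_ : _ = d *: g x)//.
  by rewrite rnormZ ler_wpM2l ?opnorm_ub// -lecR ReK normr_ge0.
apply/eqP; rewrite eq_le hle andTb.
have [->|c0] := eqVneq c 0.
  by rewrite normr0 mul0r opnorm_ge0.
have := hle c^-1 (c *: f); rewrite scalerA mulVf// scale1r.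
have rc : 0 < complex.Re `|c| by rewrite -ltcR ReK normr_gt0.
have -> : complex.Re `|c^-1| = (complex.Re `|c|)^-1.
  by apply: (@complexI R); rewrite fmorphV/= !ReK normfV.
by rewrite ler_pdivlMl.
Qed.

HB.instance Definition _ := Lmodule_isNormed.Build R[i] contlin
  ler_opnormD opnormZ opnorm_eq0.

End continuous_linear_maps.

(* [fderiv G x] is the Frechet derivative of [G] at [x] as an element of
   L(X, Y); it is only meaningful when [G] is differentiable at [x]. *)
Definition fderiv (R : realType) (X Y : normedModType R[i]) (G : X -> Y)
  (x : X) : contlin X Y := insubd (0 : contlin X Y) ('d G x : X -> Y).

Lemma fderivE (R : realType) (X Y : normedModType R[i]) (G : X -> Y) (x : X) :
  differentiable G x -> fderiv G x = 'd G x :> (X -> Y).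
Proof.
move=> dG; rewrite /fderiv insubdK//; apply/clinP; split.
  by move=> k u v; rewrite linearP.
exact: diff_continuous.
Qed.

(* L(X, L(X, ... L(X, Y))), the space of bounded s-linear maps X^s -> Y. *)
Fixpoint multilin (R : realType) (X Y : normedModType R[i]) (s : nat) :
    normedModType R[i] :=
  if s is s'.+1 then contlin X (multilin X Y s') else Y.

Fixpoint fderivn (R : realType) (X Y : normedModType R[i]) (s : nat)
    (F : X -> Y) : X -> multilin X Y s :=
  if s is s'.+1 then fderiv (fderivn s' F) else F.

(* T(z, ..., z) *)
Fixpoint eval_diag (R : realType) (X Y : normedModType R[i]) (s : nat) :
    multilin X Y s -> X -> Y :=
  if s is s'.+1 then fun T z => eval_diag (T z) z else fun T _ => T.

(* P_s(z) = D^s F(0)(z, ..., z) / s! *)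
Definition hompoly (R : realType) (X Y : normedModType R[i]) (F : X -> Y)
  (s : nat) (z : X) : Y := (s`!%:R : R[i])^-1 *: eval_diag (fderivn s F 0) z.

Definition holomorphic (R : realType) (X Y : normedModType R[i]) (D : set X)
  (F : X -> Y) : Prop := forall z, D z -> differentiable F z.

Definition unit_ball (R : realType) (X : normedModType R[i]) : set X :=
  [set z | `|z| < 1].

Definition Cn (R : realType) (n : nat) : normedModType R[i] := 'rV[R[i]]_n.

Definition polydisc (R : realType) (n : nat) : set (Cn R n) :=
  [set w : 'rV[R[i]]_n | forall j, `|w 0 j| < 1].

(* The holomorphic maps F : B_X -> closed polydisc with expansion
   a + \sum_(s >= 1) P_s and with |a_j| = |a|_oo for all j.  A map on B_X is
   represented by a map on X whose values outside B_X are irrelevant. *)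
Definition admissible (R : realType) (X : normedModType R[i]) (n : nat)
    (a : Cn R n) (F : X -> Cn R n) : Prop :=
  [/\ closure (@polydisc R n) a,
      forall z, unit_ball z -> closure (@polydisc R n) (F z),
      holomorphic (@unit_ball R X) F,
      forall z, unit_ball z ->
        (fun m => a + \sum_(1 <= s < m.+1) hompoly F s z) @ \oo --> F z
    & forall j, `|(a : 'rV[R[i]]_n) 0 j| = `|a|].

Definition majorant (R : realType) (X : normedModType R[i]) (n : nat)
    (a : Cn R n) (F : X -> Cn R n) (z : X) : \bar R :=
  (\sum_(0 <= k <oo) (rnorm a * rnorm z ^+ k)%:E +
   \sum_(1 <= N <oo)
     (\sum_(1 <= k < N.+1)
        rnorm z ^+ k.-1 * rnorm (hompoly F (N - k).+1 z))%:E)%E.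

(* Main.v *)
Require Import Defs.
From HB Require Import structures.
From mathcomp Require Import all_boot all_order all_algebra.
From mathcomp Require Import all_classical all_reals all_analysis.
From mathcomp Require Import ring lra zify.
Import Order.TTheory GRing.Theory Num.Theory.
Import numFieldNormedType.Exports.
Set Implicit Arguments.
Unset Strict Implicit.
Unset Printing Implicit Defensive.
Local Open Scope classical_set_scope.
Local Open Scope ring_scope.

(** Write r for the norm of z and A for the norm of a.  Collecting
    the terms with the same P_s, the majorant series is
    (A + sum_s |P_s(z)|) / (1 - r), so the statement is Bohr's theorem for the
    power series of F along complex lines, one coordinate at a time.

    The inequality.  On the line through z = r u with |u| = 1, the j-th
    coordinate of F is a power series c_0 + c_1 x + ... bounded by 1 on the
    unit disc, with c_0 = a_j and c_s = P_s(u)_j.  Averaging such a series over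
    a circle against the nonnegative kernel |1 + eta x^(-s)|^2, for a suitable
    unimodular eta, gives 2 |c_0| + |c_s| <= 2
    ([bounded_power_series_coef_le]).  The average is taken over roots of unity
    ([norm_sum_coef_le]), which isolates coefficients exactly for finite sums;
    on a circle of radius less than 1 the partial sums of the series are bounded
    by 1 + e ([partial_sums_le]).  Since all |a_j| are equal to A, the same
    bound holds for the maximum norm: |P_s(z)| <= 2 (1 - A) r^s
    ([admissible_coef_le]).  The majorant is then at most
    A / (1 - r) + 2 (1 - A) r / (1 - r)^2, and this is at most 1 / (1 - r) as
    soon as 2 r <= 1 - r.

    Sharpness.  The Hahn-Banach theorem provides a functional f of norm at most
    1 with |f z| = |z| ([norming_functional]).  Composing it with the Moebius
    map x |-> (A - x) / (1 - A x) and repeating the result in all coordinates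
    gives an admissible F whose majorant at z is
    A / (1 - r) + (1 - A^2) r / ((1 - r) (1 - A r)); this exceeds 1 / (1 - r)
    exactly when r (1 + 2 A) > 1, which holds for A close to 1 if r > 1/3
    ([majorant_moebius_map_gt]).  The homogeneous terms are defined through
    iterated Frechet derivatives; those of F are scalar multiples of the tensor
    powers of f, the scalars being the derivatives of the Moebius map
    ([fderivn_moebius_map]). *)

(** * Averages over roots of unity *)

(** Orders that are powers of 2 are enough for averaging, and there primitive
    roots are iterated square roots of -1. *)
Lemma prim_root_pow2_exists (C : numClosedFieldType) (k : nat) :
  exists w : C, (2 ^ k.+1).-primitive_root w.
Proof.
have [w wk] : exists w : C, w ^+ (2 ^ k) = -1.
  elim: k => [|k [w wk]]; first by exists (-1).
  by exists (sqrtC w); rewrite expnS exprM sqrtCK.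
have wk2 : w ^+ (2 ^ k.+1) = 1 by rewrite expnSr exprM wk sqrrN expr1n.
have [m wm] := prim_order_exists (expn_gt0 2 k.+1 : (0 < 2 ^ k.+1)%N) wk2.
move=> /(dvdn_pfactor _ _ (isT : prime 2))[j]; rewrite leq_eqVlt => /orP[/eqP ->|].
  by move=> <-; exists w.
rewrite ltnS => jk mE; have : w ^+ (2 ^ k) == 1.
  by rewrite -(prim_order_dvd wm) mE dvdn_exp2l.
by rewrite wk -subr_eq0 -opprD oppr_eq0 -(natrD _ 1 1) pnatr_eq0.
Qed.

Lemma sum_prim_root_exp (C : fieldType) (M n : nat) (w : C) :
  M.-primitive_root w ->
  \sum_(k < M) w ^+ (k * n) = if (M %| n)%N then M%:R else 0.
Proof.
move=> wM; have e k : w ^+ (k * n) = (w ^+ n) ^+ k by rewrite mulnC exprM.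
under eq_bigr do rewrite e.
case: ifPn => [|nd].
  rewrite (prim_order_dvd wM) => /eqP ->.
  by under eq_bigr do rewrite expr1n; rewrite sumr_const card_ord.
have : w ^+ n - 1 != 0 by rewrite subr_eq0 -(prim_order_dvd wM).
have := subrX1 (w ^+ n) M; rewrite -exprM mulnC exprM (prim_expr_order wM).
rewrite expr1n subrr => /esym/eqP.
by rewrite mulf_eq0 => /orP[/eqP ->|/eqP//]; rewrite eqxx.
Qed.

Lemma polar (C : numFieldType) (x : C) :
  exists2 u : C, `|u| = 1 & x = `|x| * u.
Proof.
have [->|x0] := eqVneq x 0; first by exists 1; rewrite ?normr1 // normr0 mul0r.
exists (x / `|x|); first by rewrite normf_div normr_id divff ?normr_eq0.
by rewrite mulrC divfK ?normr_eq0.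
Qed.

(** Let p be the given sum.  The mean of p(x) |1 + eta x^(-s)|^2 over the M-th
    roots of unity is 2 c_0 + eta c_s when M exceeds all the exponents involved,
    and the mean of the kernel itself is 2; as the kernel is nonnegative, the
    first mean is at most 2 B in modulus.  The unimodular eta is chosen to align
    the two terms. *)
Lemma norm_sum_coef_le (C : numClosedFieldType) (c : nat -> C) (m s : nat) (B : C) :
  (0 < s < m)%N ->
  (forall x : C, `|x| = 1 -> `|\sum_(j < m) c j * x ^+ j| <= B) ->
  2 * `|c 0%N| + `|c s| <= 2 * B.
Proof.
move=> /andP[s0 sm] cB.
have [u u1 c0E] := polar (c 0%N); have [v v1 csE] := polar (c s).
have v0 : v != 0 by rewrite -normr_eq0 v1 oner_eq0.
pose M := (2 ^ (m + s).+1)%N.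
have msM : (m + s < M)%N by apply: ltn_trans (ltnSn _) (ltn_expl _ _).
have M0 : (0 < M)%N by apply: leq_ltn_trans msM.
have sM : (s < M)%N by lia.
have [w wM] := prim_root_pow2_exists C (m + s).
have w1 : `|w| = 1.
  have /eqP := congr1 Num.norm (prim_expr_order wM).
  by rewrite normrX normr1 pexprn_eq1 ?normr_ge0 // gtn_eqF //= => /eqP.
have wk1 k : `|w ^+ k| = 1 by rewrite normrX w1 expr1n.
pose eta := u / v; have eta1 : `|eta| = 1 by rewrite normf_div u1 v1 divr1.
(* The exponent M - s stands for -s. *)
pose y k := eta * w ^+ (k * (M - s)).
have y1 k : `|y k| = 1 by rewrite normrM eta1 wk1 mulr1.
have yJ k : (y k)^* = eta^-1 * w ^+ (k * s).
  have yk0 : y k != 0 by rewrite -normr_eq0 y1 oner_eq0.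
  apply: (mulfI yk0); rewrite -normCK y1 expr1n /y.
  rewrite mulrACA divff ?mul1r; last by rewrite -normr_eq0 eta1 oner_eq0.
  by rewrite -exprD -mulnDr subnK 1?ltnW // mulnC exprM (prim_expr_order wM) expr1n.
pose W k := 2 + y k + (y k)^*.
have W0 k : 0 <= W k.
  suff -> : W k = `|1 + y k| ^+ 2 by rewrite exprn_ge0.
  rewrite normCK rmorphD rmorph1 mulrDl mul1r mulrDr mulr1 -normCK y1 expr1n /W.
  by ring.
have key j : (j < m)%N -> \sum_(k < M) w ^+ (k * j) * W k =
    M%:R * (2 * (j == 0)%:R + eta * (j == s)%:R).
  move=> jm; have jsM : (j + s < M)%N by lia.
  transitivity (2 * (\sum_(k < M) w ^+ (k * j)) +
      eta * (\sum_(k < M) w ^+ (k * (j + (M - s)))) +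
      eta^-1 * \sum_(k < M) w ^+ (k * (j + s))).
    rewrite !mulr_sumr -!big_split; apply: eq_bigr => k _ /=.
    rewrite /W yJ /y !mulnDr !exprD; ring.
  rewrite !(sum_prim_root_exp _ wM).
  have -> : (M %| j)%N = (j == 0)%N.
    case: j {jsM} jm => [|j] jm; first by rewrite dvdn0.
    by rewrite gtnNdvd //; lia.
  have -> : (M %| j + s)%N = false by rewrite gtnNdvd //; lia.
  have -> : (M %| j + (M - s))%N = (j == s).
    case: (ltngtP j s) => js.
    - by rewrite gtnNdvd //; lia.
    - rewrite (_ : (j + (M - s) = (j - s) + M)%N); last by lia.
      by rewrite dvdn_addl // gtnNdvd //; lia.
    - by rewrite js subnKC ?dvdnn // ltnW.
  by case: eqP => _; case: eqP => _ /=; ring.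
have sumW : \sum_(k < M) W k = M%:R * 2.
  have := key 0%N (ltn_trans s0 sm).
  rewrite eqxx (negbTE (_ : 0%N != s)); last by rewrite neq_ltn s0.
  rewrite mulr1 mulr0 addr0 => <-.
  by apply: eq_bigr => k _; rewrite muln0 mul1r.
have sumf : \sum_(k < M) (\sum_(j < m) c j * (w ^+ k) ^+ j) * W k =
    M%:R * (2 * c 0%N + eta * c s).
  under eq_bigr do rewrite mulr_suml.
  rewrite exchange_big /=.
  transitivity (\sum_(j < m)
      c j * (M%:R * (2 * (j == 0 :> nat)%:R + eta * (j == s :> nat)%:R))).
    apply: eq_bigr => j _; rewrite -key // mulr_sumr.
    by apply: eq_bigr => k _; rewrite -exprM mulrA.
  have m0 : (0 < m)%N := ltn_trans s0 sm.
  rewrite (bigD1 (Ordinal m0)) //= (bigD1 (Ordinal sm)) /=; last first.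
    by rewrite -val_eqE /= neq_ltn s0 orbT.
  rewrite big1 => [|j /andP[j0 js]]; last first.
    by rewrite -!val_eqE /= in j0 js; rewrite (negbTE j0) (negbTE js) !mulr0 addr0 !mulr0.
  rewrite !eqxx; have [e|_] := eqVneq 0%N s; first by move: s0; rewrite -e.
  have [e|_] := eqVneq s 0%N; first by move: s0; rewrite e.
  by rewrite /=; ring.
have : `|M%:R * (2 * c 0%N + eta * c s)| <= B * (M%:R * 2).
  rewrite -sumf -sumW mulr_sumr; apply: le_trans (ler_norm_sum _ _ _) _.
  apply: ler_sum => k _; rewrite normrM (ger0_norm (W0 k)) ler_wpM2r //.
  exact: cB.
rewrite normrM normr_nat mulrCA ler_pM2l ?ltr0n // (mulrC B).
suff -> : `|2 * c 0%N + eta * c s| = 2 * `|c 0%N| + `|c s| by [].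
have -> : 2 * c 0%N + eta * c s = (2 * `|c 0%N| + `|c s|) * u.
  by rewrite {1}c0E {1}csE /eta; field.
by rewrite normrM u1 mulr1 ger0_norm // addr_ge0 // mulr_ge0.
Qed.

(** * Coefficients of bounded power series *)

Lemma rnorm_le (R : realType) (V : normedModType R[i]) (x : V) (e : R) :
  (rnorm x <= e) = (`|x| <= e%:C%C).
Proof. by rewrite -rnormE lecR. Qed.

Lemma rnormM (R : realType) (x y : R[i]^o) :
  rnorm (x * y : R[i]^o) = rnorm x * rnorm y.
Proof. by apply: (@complexI R); rewrite rmorphM /= !rnormE normrM. Qed.

Lemma rnormX (R : realType) (x : R[i]^o) (k : nat) :
  rnorm (x ^+ k : R[i]^o) = rnorm x ^+ k.
Proof. by apply: (@complexI R); rewrite rmorphXn /= !rnormE normrX. Qed.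

Lemma rnormC (R : realType) (x : R) : rnorm (x%:C%C : R[i]^o) = `|x|.
Proof.
by apply: (@complexI R); rewrite rnormE normc_def /= expr0n /= addr0 sqrtr_sqr.
Qed.

Lemma rnorm0 (R : realType) (V : normedModType R[i]) : rnorm (0 : V) = 0.
Proof. by rewrite /rnorm normr0. Qed.

Lemma rnormN (R : realType) (V : normedModType R[i]) (x : V) :
  rnorm (- x) = rnorm x.
Proof. by rewrite /rnorm normrN. Qed.

Lemma rnorm_sum (R : realType) (V : normedModType R[i]) (I : Type) (r : seq I)
    (P : pred I) (f : I -> V) :
  rnorm (\sum_(i <- r | P i) f i) <= \sum_(i <- r | P i) rnorm (f i).
Proof.
elim/big_rec2: _ => [|i y x _ h]; first by rewrite rnorm0.
by apply: le_trans (rnormD _ _) _; rewrite lerD2l.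
Qed.

(** Turns limits in spaces over R[i] into limits of real sequences, where
    geometric sequences and the total order are at hand. *)
Lemma cvg_rnormP (R : realType) (V : normedModType R[i]) (u : nat -> V) (l : V) :
  u @ \oo --> l <-> (fun m => rnorm (l - u m)) @ \oo --> (0 : R).
Proof.
split.
  move=> /cvgrPdist_lt h; apply/cvgr0Pnorm_lt => e e0.
  have /h : 0 < e%:C%C :> R[i] by rewrite ltcR.
  apply: filterS => m; rewrite -rnormE ltcR => he.
  by rewrite ger0_norm // rnorm_ge0.
move=> /cvgr0Pnorm_lt h; apply/cvgrPdist_lt => e e0.
have eE : e = (complex.Re e)%:C%C by case: e e0 => a b; rewrite ltcE /= => /andP[/eqP ->].
move: e0; rewrite eE ltcR => /h; apply: filterS => m.
by rewrite ger0_norm ?rnorm_ge0 // -rnormE ltcR.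
Qed.

Lemma sum_geometric_le (R : realFieldType) (q : R) (m n : nat) :
  0 <= q < 1 -> (m <= n)%N ->
  \sum_(m <= j < n) q ^+ j <= q ^+ m / (1 - q).
Proof.
move=> /andP[q0 q1] mn; rewrite ler_pdivlMr ?subr_gt0 //.
suff -> : (\sum_(m <= j < n) q ^+ j) * (1 - q) = q ^+ m - q ^+ n.
  by rewrite gerBl exprn_ge0.
elim: n mn => [|n IHn].
  by rewrite leqn0 => /eqP ->; rewrite big_geq // mul0r subrr.
rewrite leq_eqVlt => /orP[/eqP ->|]; first by rewrite big_geq // mul0r subrr.
by rewrite ltnS => mn; rewrite big_nat_recr //= mulrDl IHn // exprS; ring.
Qed.

Section bounded_power_series.
Variables (R : realType) (c : nat -> R[i]).
Hypothesis c_bounded : forall x : R[i], `|x| < 1 -> exists2 w : R[i]^o,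
  `|w| <= 1 & (fun m => (\sum_(0 <= j < m) c j * x ^+ j) : R[i]^o) @ \oo --> w.

(** Convergence at a radius s strictly between r and 1 makes the coefficients
    O(s^(-j)), so that the tails are geometric, uniformly on the circle of
    radius r. *)
Lemma partial_sums_le (r e : R) : 0 < r < 1 -> 0 < e ->
  exists m0, forall m, (m0 <= m)%N -> forall x : R[i], `|x| = r%:C%C ->
    `|\sum_(0 <= j < m) c j * x ^+ j| <= (1 + e)%:C%C.
Proof.
move=> /andP[r0 r1] e0.
pose s := (1 + r) / 2; have rs : r < s by rewrite /s; lra.
have s1 : s < 1 by rewrite /s; lra.
have s0 : 0 < s by apply: lt_trans rs.
pose q := r / s.
have q01 : 0 <= q < 1.
  by rewrite /q divr_ge0 ?(ltW r0) ?(ltW s0) //= ltr_pdivrMr // mul1r.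
have [K cK] : exists K : R, forall j, rnorm (c j : R[i]^o) * s ^+ j <= K.
  have [|w _ cw] := c_bounded (x := s%:C%C).
    by rewrite -(rnormE (_ : R[i]^o)) rnormC gtr0_norm // ltcR.
  have /cvg_series_cvg_0/cvgP/cvg_seq_bounded :
      cvgn (series (fun j => c j * s%:C%C ^+ j : R[i]^o)) by apply/cvg_ex; exists w.
  move=> [M [Mreal /(_ (M + 1))]]; rewrite ltrDl ltr01 => /(_ isT) hM.
  exists (complex.Re (M + 1)) => j.
  rewrite -(gtr0_norm (exprn_gt0 j s0)) -rnormC -rnormM rnorm_le RRe_real; last first.
    by rewrite realD // real1.
  by have := hM j I; rewrite rmorphXn.
have [m0 hm0] : exists m0, forall m, (m0 <= m)%N -> K * (q ^+ m / (1 - q)) <= e / 2.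
  have /cvgr0Pnorm_lt/(_ (e / 2)) : geometric (K / (1 - q)) q @ \oo --> 0.
    by apply: cvg_geometric; rewrite ger0_norm; case/andP: q01.
  rewrite divr_gt0 // => /(_ isT)[m0 _ hm0]; exists m0 => m m0m.
  have := hm0 m m0m; rewrite /= => h; apply: le_trans (ltW h).
  by apply: le_trans (ler_norm _); rewrite mulrA mulrAC.
exists m0 => m m0m x xr.
have [|w w1 fw] := c_bounded (x := x); first by rewrite xr ltcR.
have /cvg_rnormP/cvgr0Pnorm_lt/(_ (e / 2)) := fw.
rewrite divr_gt0 // => /(_ isT)[n1 _ hn1].
pose n := maxn n1 m.
have mn : (m <= n)%N by rewrite leq_maxr.
have /= := hn1 n (leq_maxl _ _).
rewrite ger0_norm ?rnorm_ge0 // => hn.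
rewrite -(rnorm_le (_ : R[i]^o)).
have tail : rnorm (\sum_(m <= j < n) c j * x ^+ j : R[i]^o) <= e / 2.
  apply: le_trans (hm0 _ m0m).
  apply: le_trans (rnorm_sum _ _ _) _.
  apply: le_trans (_ : \sum_(m <= j < n) K * q ^+ j <= _); last first.
    rewrite -mulr_sumr ler_wpM2l ?sum_geometric_le //.
    by apply: le_trans (cK 0%N); rewrite expr0 mulr1 rnorm_ge0.
  apply: ler_sum => j _.
  have -> : rnorm (c j * x ^+ j : R[i]^o) = rnorm (c j : R[i]^o) * s ^+ j * q ^+ j.
    rewrite rnormM rnormX {2}/rnorm xr /= -mulrA -exprMn /q.
    by rewrite mulrCA divff ?mulr1 // gt_eqF.
  by rewrite ler_wpM2r ?exprn_ge0 //; case/andP: q01.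
have -> : \sum_(0 <= j < m) c j * x ^+ j =
    w - (w - \sum_(0 <= j < n) c j * x ^+ j) - \sum_(m <= j < n) c j * x ^+ j.
  by rewrite (big_cat_nat (leq0n m) mn) /=; ring.
apply: le_trans (rnormD _ _) _; rewrite rnormN.
have := rnormD w (- (w - \sum_(0 <= j < n) c j * x ^+ j)).
rewrite rnormN => h.
have : rnorm w <= 1 by rewrite rnorm_le.
by move: h hn tail => /=; lra.
Qed.

(** [norm_sum_coef_le] applies to long partial sums on a circle of radius r with
    the bound 1 + e; let e tend to 0 and r to 1. *)
Lemma bounded_power_series_coef_le (k : nat) : (0 < k)%N ->
  2 * rnorm (c 0%N : R[i]^o) + rnorm (c k : R[i]^o) <= 2.
Proof.
move=> k0; set a := rnorm (c 0%N : _^o); set b := rnorm (c k : _^o).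
have b0 : 0 <= b by exact: rnorm_ge0.
have radius r : 0 < r < 1 -> 2 * a + b * r ^+ k <= 2.
  move=> r01; apply/ler_addgt0Pr => e e0.
  have [|m0 hm0] := partial_sums_le r01 (_ : 0 < e / 2); first by rewrite divr_gt0.
  have r0 : 0 <= r by case/andP: r01 => /ltW.
  have := @norm_sum_coef_le _ (fun j => c j * r%:C%C ^+ j)
    (maxn m0 k.+1) k (1 + e / 2)%:C%C.
  rewrite k0 leq_maxr => /(_ isT) h.
  rewrite -lecR; have -> : (2 + e)%:C%C = 2 * (1 + e / 2)%:C%C :> R[i].
    by rewrite -(rmorph_nat (real_complex R) 2) -rmorphM; congr (_%:C)%C; field.
  move: h; rewrite expr0 mulr1 normrM normrX -!(rnormE (_ : R[i]^o)) rnormC ger0_norm //.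
  rewrite -(rmorph_nat (real_complex R) 2) -!(rmorphXn, rmorphM, rmorphD) /=; apply.
  move=> x x1; have := hm0 _ (leq_maxl m0 k.+1) (r%:C%C * x).
  rewrite normrM x1 mulr1 -(rnormE (_ : R[i]^o)) rnormC ger0_norm // => /(_ erefl).
  rewrite big_mkord; congr (`|_| <= _); apply: eq_bigr => j _.
  by rewrite exprMn mulrA.
apply/ler_addgt0Pr => e e0.
(* r = 1 - d, where r ^ k >= 1 - k d costs at most e *)
pose d := Num.min (1 / 2) (e / (b * k%:R + 1)).
have bk0 : 0 <= b * k%:R by rewrite mulr_ge0.
have d0 : 0 < d by rewrite lt_min divr_gt0 //= divr_gt0 // ltr_wpDl.
have d2 : d <= 1 / 2 by rewrite ge_min lexx.
have de : b * k%:R * d <= e.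
  apply: le_trans (_ : b * k%:R * (e / (b * k%:R + 1)) <= _).
    by rewrite ler_wpM2l // ge_min lexx orbT.
  by rewrite mulrCA ger_pMr // ler_pdivrMr ?ltr_wpDl // mul1r lerDl.
have bern : 1 - k%:R * d <= (1 - d) ^+ k.
  elim: (k) => [|j IHj]; first by rewrite mul0r subr0.
  have j0 : 0 <= j%:R :> R by [].
  rewrite exprS -natr1; have : 0 <= (1 - d) by lra.
  by move=> /ler_wpM2l/(_ _ _ IHj); nra.
have := radius (1 - d); rewrite (_ : _ < _ < _ = true) => [/(_ isT)|]; last by lra.
by have := ler_wpM2l b0 bern; lra.
Qed.

End bounded_power_series.

(** * The inequality up to radius 1/3 *)

Lemma eval_diagZ (R : realType) (X Y : normedModType R[i]) (s : nat)
    (T : multilin X Y s) (k : R[i]) (z : X) :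
  eval_diag (k *: T) z = k *: eval_diag T z.
Proof. by elim: s T => [//|s IHs] T /=; rewrite -IHs. Qed.

Lemma eval_diag_scale (R : realType) (X Y : normedModType R[i]) (s : nat)
    (T : multilin X Y s) (k : R[i]) (z : X) :
  eval_diag T (k *: z) = k ^+ s *: eval_diag T z.
Proof.
elim: s T => [|s IHs] T /=; first by rewrite expr0 scale1r.
have [lT _] := contlinP T.
have T0 : T 0 = 0 by have := lT (-1) 0 0; rewrite scaler0 addr0 scaleN1r addNr.
have -> : T (k *: z) = k *: T z by have := lT k z 0; rewrite !addr0 T0 addr0.
by rewrite eval_diagZ IHs scalerA exprS.
Qed.

(** Along a complex line the expansion of F is thus a power series in one
    variable. *)
Lemma hompolyZ (R : realType) (X Y : normedModType R[i]) (F : X -> Y) (s : nat)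
    (k : R[i]) (z : X) :
  hompoly F s (k *: z) = k ^+ s *: hompoly F s z.
Proof. by rewrite /hompoly eval_diag_scale !scalerA mulrC. Qed.

Section max_norm.
Variables (R : realType) (n : nat).
Implicit Types w : 'rV[R[i]]_n.

Lemma rnorm_coord_le w j : rnorm (w 0 j : R[i]^o) <= rnorm (w : Cn R n).
Proof.
rewrite -lecR !rnormE [leRHS]/Num.norm /= mx_normE -[leLHS]nngE num_le.
exact: (le_bigmax _ (fun i : 'I_1 * 'I_n => `|w i.1 i.2|%:nng) (0, j)).
Qed.

Lemma rnorm_row_le w (e : R) : 0 <= e ->
  (forall j, rnorm (w 0 j : R[i]^o) <= e) -> rnorm (w : Cn R n) <= e.
Proof.
move=> e0 we; have nE : `|w : Cn R n| = mx_norm w by [].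
rewrite /rnorm nE; have [->//|] := eqVneq (mx_norm w) 0.
by move=> /mx_norm_neq0[[i j] /= ->]; rewrite (ord1 i); exact: we.
Qed.

Lemma closure_polydisc_le w j :
  closure (@polydisc R n) w -> rnorm (w 0 j : R[i]^o) <= 1.
Proof.
move=> wD; apply/ler_addgt0Pr => e e0.
have [v [/= vD]] : polydisc (n := n) `&` ball (w : Cn R n) e%:C%C !=set0.
  by apply: wD; apply: nbhsx_ballx; rewrite ltcR.
rewrite -ball_normE /ball_ /= -rnormE ltcR => we.
have -> : w 0 j = v 0 j + (w - v) 0 j by rewrite !mxE addrCA subrr addr0.
apply: le_trans (rnormD _ _) _; apply: lerD; first by rewrite rnorm_le ltW ?vD.
exact: le_trans (rnorm_coord_le _ _) (ltW we).
Qed.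

End max_norm.

Lemma sum_muln_exp_le (R : realFieldType) (r : R) (K : nat) :
  0 <= r < 1 -> \sum_(1 <= N < K) N%:R * r ^+ N <= r / (1 - r) ^+ 2.
Proof.
move=> /andP[r0 r1]; rewrite ler_pdivlMr ?exprn_gt0 ?subr_gt0 //.
have telescope m : (\sum_(1 <= N < m.+1) N%:R * r ^+ N) * (1 - r) ^+ 2 =
    r - r ^+ m.+1 * (1 + m%:R * (1 - r)).
  elim: m => [|m IHm]; first by rewrite big_geq // mul0r mul0r addr0 mulr1 expr1 subrr.
  by rewrite big_nat_recr //= mulrDl IHm -!natr1 !exprS; ring.
case: K => [|m]; first by rewrite big_geq // mul0r.
rewrite telescope gerBl mulr_ge0 ?exprn_ge0 // addr_ge0 // mulr_ge0 //.
by rewrite subr_ge0 ltW.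
Qed.

(** Each of the N products in the N-th inner sum is at most D r^N, whence the
    series of the N r^N. *)
Lemma majorant_le (R : realType) (X : normedModType R[i]) (n : nat)
    (a : Cn R n) (F : X -> Cn R n) (z : X) (D : R) : rnorm z < 1 -> 0 <= D ->
  (forall s, (0 < s)%N -> rnorm (hompoly F s z) <= D * rnorm z ^+ s) ->
  (majorant a F z <=
    (rnorm a / (1 - rnorm z) + D * (rnorm z / (1 - rnorm z) ^+ 2))%:E)%E.
Proof.
set r := rnorm z => r1 D0 PD; have r0 : 0 <= r := rnorm_ge0 z.
have r01 : 0 <= r < 1 by rewrite r0.
rewrite /majorant -/r EFinD; apply: leeD.
  apply: lime_le.
    by apply: is_cvg_nneseries => k _ _; rewrite lee_fin mulr_ge0 ?exprn_ge0 ?rnorm_ge0.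
  apply: nearW => m; rewrite sumEFin lee_fin -mulr_sumr ler_wpM2l ?rnorm_ge0 //.
  by apply: le_trans (sum_geometric_le r01 (leq0n m)) _; rewrite mul1r.
apply: lime_le.
  apply: is_cvg_nneseries => N _ _; rewrite lee_fin sumr_ge0 // => k _.
  by rewrite mulr_ge0 ?exprn_ge0 ?rnorm_ge0.
apply: nearW => m; rewrite sumEFin lee_fin.
apply: le_trans (_ : \sum_(1 <= N < m) D * (N%:R * r ^+ N) <= _); last first.
  by rewrite -mulr_sumr ler_wpM2l // sum_muln_exp_le.
rewrite big_nat_cond [leRHS]big_nat_cond; apply: ler_sum => N /andP[/andP[N1 _] _].
apply: le_trans (_ : \sum_(1 <= k < N.+1) D * r ^+ N <= _); last first.
  by rewrite sumr_const_nat subn1 /= -[leLHS]mulr_natl mulrCA.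
rewrite big_nat_cond [leRHS]big_nat_cond; apply: ler_sum => k /andP[/andP[k1 kN] _].
apply: le_trans (_ : r ^+ k.-1 * (D * r ^+ (N - k).+1) <= _).
  by rewrite ler_wpM2l ?exprn_ge0 // PD.
by rewrite mulrCA -exprD (_ : (k.-1 + (N - k).+1 = N)%N) //; lia.
Qed.

(** The coefficient bound 2 (1 - |a_j|) for the j-th coordinate is the same for
    all j, because all the |a_j| are equal to the norm of a. *)
Lemma admissible_coef_le (R : realType) (X : normedModType R[i]) (n : nat)
    (a : Cn R n) (F : X -> Cn R n) (z : X) (s : nat) : admissible a F ->
  (0 < s)%N -> rnorm (hompoly F s z) <= 2 * (1 - rnorm a) * rnorm z ^+ s.
Proof.
move=> [aD FD _ Fsum aE] s0.
have a1 : 0 <= 2 * (1 - rnorm a).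
  rewrite mulr_ge0 // subr_ge0; apply: rnorm_row_le => // j.
  exact: closure_polydisc_le.
have [->|z0] := eqVneq z 0.
  rewrite -{1}(scale0r (0 : X)) hompolyZ expr0n gtn_eqF // scale0r.
  by rewrite [leLHS]rnorm0 mulr_ge0 ?exprn_ge0 ?rnorm_ge0.
have r0 : `|z| != 0 by rewrite normr_eq0.
pose u := `|z|^-1 *: z.
have zu : z = `|z| *: u by rewrite scalerA divff // scale1r.
have u1 : `|u| = 1 by rewrite normrZ normfV normr_id mulVf.
rewrite {1}zu hompolyZ rnormZ normrX normr_id -rnormE -rmorphXn /= mulrC.
apply: ler_wpM2r; first by rewrite exprn_ge0 ?rnorm_ge0.
apply: rnorm_row_le => // j.
pose c k := if k is 0 then a 0 j else hompoly F k u 0 j.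
have aj : rnorm (c 0%N : R[i]^o) = rnorm a by exact: (congr1 (@complex.Re R) (aE j)).
have -> : hompoly F s u 0 j = c s by case: (s) s0.
rewrite -aj mulrBr mulr1 lerBrDl.
apply: bounded_power_series_coef_le => // x x1.
have xu1 : unit_ball (x *: u) by rewrite /unit_ball /= normrZ u1 mulr1.
exists (F (x *: u) 0 j); first by rewrite -rnorm_le; exact/closure_polydisc_le/FD.
rewrite -cvg_shiftS /=.
rewrite [X in X @ _](_ : _ = fun m =>
    (a + \sum_(1 <= k < m.+1) hompoly F k (x *: u) : 'rV_n) 0 j).
  exact: (continuous_cvg _ (@coord_continuous R[i] 1 n 0 j (F (x *: u))) (Fsum _ xu1)).
apply/funext => m /=.
rewrite mxE big_nat_recl // expr0 mulr1 big_add1 summxE; congr (_ + _).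
by apply: eq_bigr => k _; rewrite hompolyZ mxE mulrC.
Qed.

Lemma majorant_admissible_le (R : realType) (X : normedModType R[i]) (n : nat)
    (a : Cn R n) (F : X -> Cn R n) (z : X) : admissible a F ->
  rnorm z <= 1 / 3%:R -> (majorant a F z <= (1 / (1 - rnorm z))%:E)%E.
Proof.
move=> aF r3; have [aD _ _ _ _] := aF.
have r0 : 0 <= rnorm z := rnorm_ge0 z.
have a1 : rnorm a <= 1 by apply: rnorm_row_le => // j; exact: closure_polydisc_le.
apply: le_trans (majorant_le a (D := 2 * (1 - rnorm a)) _ _ _) _.
- by apply: le_lt_trans r3 _; lra.
- by lra.
- by move=> s s0; exact: admissible_coef_le.
set r := rnorm z in r0 r3 *; set A := rnorm a in a1 *.
have r1 : 1 - r != 0 by lra.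
rewrite lee_fin -subr_ge0.
have -> : 1 / (1 - r) - (A / (1 - r) + 2 * (1 - A) * (r / (1 - r) ^+ 2)) =
    (1 - A) * (1 - 3 * r) / (1 - r) ^+ 2 by field.
by rewrite divr_ge0 ?exprn_ge0 ?mulr_ge0 //; lra.
Qed.

(** * Norming functionals *)

Section sublinear.
Variables (R : realType) (V : lmodType R).
Implicit Types (p q : V -> R) (x y v : V).

(** Positive homogeneity is required as an inequality only, which is easier to
    establish for infima; applied to k and k^-1 it yields the equality
    [sublinearZ]. *)
Definition sublinear q : Prop :=
  (forall x y, q (x + y) <= q x + q y) /\
  (forall (k : R) x, 0 < k -> q (k *: x) <= k * q x).

Lemma sublinearZ q k x : sublinear q -> 0 <= k -> q (k *: x) = k * q x.
Proof.
move=> [_ qZ]; rewrite le_eqVlt => /orP[/eqP <-|k0].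
  have q1 := qZ (1 / 2) 0 ltac:(lra); have q2 := qZ 2 0 ltac:(lra).
  by move: q1 q2; rewrite !scaler0 scale0r mul0r; lra.
apply/eqP; rewrite eq_le qZ //= -ler_pdivlMl //.
have := qZ k^-1 (k *: x); rewrite scalerA mulVf ?gt_eqF // scale1r invr_gt0.
exact.
Qed.

Lemma sublinear0 q : sublinear q -> q 0 = 0.
Proof. by move=> qs; rewrite -(scale0r 0) sublinearZ // mul0r. Qed.

Lemma sublinear_ge q x : sublinear q -> - q (- x) <= q x.
Proof.
move=> qs; have [qD _] := qs; have := qD x (- x).
by rewrite subrr sublinear0 //; lra.
Qed.

(** The largest sublinear functional below q whose value at -v is at most
    - q v: passing from q to it makes q linear along v. *)
Definition directional q v x : R :=
  inf [set q (x + t *: v) - t * q v | t in [set t | 0 <= t]].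

Lemma directional_le q v x t : sublinear q -> 0 <= t ->
  directional q v x <= q (x + t *: v) - t * q v.
Proof.
move=> qs t0; apply: ge_inf; last by exists t.
exists (- q (- x)) => _ [s s0 <-]; have [qD _] := qs.
have := qD (x + s *: v) (- x); rewrite addrAC subrr add0r sublinearZ //.
by lra.
Qed.

Lemma le_directional q v x e :
  (forall t, 0 <= t -> e <= q (x + t *: v) - t * q v) -> e <= directional q v x.
Proof.
move=> h; apply: lb_le_inf; last by move=> _ [t t0 <-]; exact: h.
by exists (q (x + 0 *: v) - 0 * q v), 0 => //=.
Qed.

Lemma directional_le_id q v x : sublinear q -> directional q v x <= q x.
Proof.
by move=> qs; have := directional_le v x qs (lexx 0); rewrite scale0r mul0r addr0 subr0.
Qed.

Lemma directional_sublinear q v : sublinear q -> sublinear (directional q v).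
Proof.
move=> qs; have [qD _] := qs; split=> [x y|k x k0].
  rewrite -lerBlDl; apply: le_directional => t t0.
  rewrite lerBlDl -lerBlDr; apply: le_directional => s s0.
  rewrite lerBlDr; apply: le_trans (directional_le _ _ qs (addr_ge0 s0 t0)) _.
  have := qD (x + s *: v) (y + t *: v).
  by rewrite addrACA -scalerDl mulrDl; lra.
rewrite -ler_pdivrMl //; apply: le_directional => t t0; rewrite ler_pdivrMl //.
apply: le_trans (directional_le _ _ qs (mulr_ge0 (ltW k0) t0)) _.
by rewrite -scalerA -scalerDr sublinearZ ?(ltW k0) // mulrBr mulrA.
Qed.

(** The infimum of a chain of sublinear functionals below p is again one of
    them: it is finite because q x >= - p (- x) for each of them. *)
Lemma minimal_sublinear p : sublinear p ->
  exists q, [/\ sublinear q, forall x, q x <= p x &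
    forall q', sublinear q' -> (forall x, q' x <= q x) -> q' = q].
Proof.
move=> ps; pose T := {q : V -> R | sublinear q /\ forall x, q x <= p x}.
pose below (q q' : T) : bool := `[< forall x, sval q' x <= sval q x >].
have [| | |A Atot|[q [qs qp]] qmin] := @Zorn T below.
- by move=> q; apply/asboolP.
- move=> q1 q2 q3 /asboolP q12 /asboolP q23; apply/asboolP => x.
  exact: le_trans (q23 x) (q12 x).
- move=> [q1 P1] [q2 P2] /asboolP /= q12 /asboolP /= q21; apply/eq_exist/funext => x.
  by apply/eqP; rewrite eq_le q12 q21.
- have [[q0 Aq0]|A0] := pselect (A !=set0); last first.
    by exists (exist _ p (conj ps (fun x => lexx _))) => q Aq; case: A0; exists q.
  pose m x := inf [set sval q x | q in A].
  have mle (q : T) x : A q -> m x <= sval q x.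
    move=> Aq; apply: ge_inf; last by exists q.
    exists (- p (- x)) => _ [[q' [q's q'p]] _ <-] /=.
    by apply: le_trans (sublinear_ge x q's); rewrite lerN2.
  have m_ge x e : (forall q : T, A q -> e <= sval q x) -> e <= m x.
    move=> h; apply: lb_le_inf; last by move=> _ [q Aq <-]; exact: h.
    by exists (sval q0 x), q0.
  have ms : sublinear m.
    split=> [x y|k x k0].
      rewrite -lerBlDl; apply: (m_ge _ _) => q1 Aq1.
      rewrite lerBlDl -lerBlDr; apply: (m_ge _ _) => q2 Aq2; rewrite lerBlDr.
      have [/asboolP q12|/asboolP q21] := Atot _ _ Aq1 Aq2.
        apply: le_trans (mle _ _ Aq2) _; have [[q2D _] _] := svalP q2.
        by apply: le_trans (q2D _ _) _; rewrite lerD2l.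
      apply: le_trans (mle _ _ Aq1) _; have [[q1D _] _] := svalP q1.
      by apply: le_trans (q1D _ _) _; rewrite lerD2r.
    rewrite -ler_pdivrMl //; apply: (m_ge _ _) => q Aq; rewrite ler_pdivrMl //.
    apply: le_trans (mle _ _ Aq) _; have [[_ qZ] _] := svalP q; exact: qZ.
  have mp x : m x <= p x.
    by apply: le_trans (mle _ x Aq0) _; have [_ q0p] := svalP q0.
  by exists (exist _ m (conj ms mp)) => q Aq; apply/asboolP => x; exact: mle.
exists q; split=> // q' q's q'q.
have q'p x : q' x <= p x := le_trans (q'q x) (qp x).
have := qmin (exist _ q' (conj q's q'p)); rewrite /below.
by move=> /(_ ltac:(exact/asboolP)) /(congr1 sval).
Qed.

(** A minimal sublinear functional coincides with its directional modifications,
    which forces additivity.  Taking it below [directional p v] rather than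
    below p makes it attain p at v. *)
Lemma hahn_banach p v : sublinear p ->
  exists f : V -> R, [/\ forall k x y, f (k *: x + y) = k * f x + f y,
    forall x, f x <= p x & f v = p v].
Proof.
move=> ps; have [f [fs fp fmin]] := minimal_sublinear (directional_sublinear v ps).
have fD x y : f (x + y) = f x + f y.
  have [fD _] := fs; apply/eqP; rewrite eq_le fD /=.
  have fE := fmin _ (directional_sublinear y fs) (fun x => directional_le_id y x fs).
  have := directional_le y x fs ler01.
  by rewrite fE scale1r mul1r; lra.
have fN x : f (- x) = - f x.
  by apply/eqP; rewrite -addr_eq0 -fD addNr sublinear0.
have fle x : f x <= p x := le_trans (fp x) (directional_le_id v x ps).
exists f; split=> // [k x y|].
  rewrite fD; congr (_ + _); case: (leP 0 k) => k0; first by rewrite sublinearZ.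
  by rewrite -[k]opprK scaleNr fN sublinearZ ?mulNr //; lra.
apply/eqP; rewrite eq_le fle /= -lerN2 -fN; apply: le_trans (fp _) _.
apply: le_trans (directional_le v (- v) ps ler01) _.
by rewrite scale1r mul1r addNr sublinear0 // sub0r.
Qed.

End sublinear.

(** An alias that carries the module structure obtained by restricting scalars. *)
Definition realified (R : realType) (X : lmodType R[i]) : Type := X.

Section realified_lmodule.
Variables (R : realType) (X : lmodType R[i]).

HB.instance Definition _ := GRing.Zmodule.on (realified X).

Let scale (k : R) (x : realified X) : realified X := k%:C%C *: (x : X).

Let scaleA (k l : R) (x : realified X) : scale k (scale l x) = scale (k * l) x.
Proof. by rewrite /scale scalerA rmorphM. Qed.

Let scale1 : left_id 1 scale.
Proof. by move=> x; rewrite /scale scale1r. Qed.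

Let scaleDr : right_distributive scale +%R.
Proof. by move=> k x y; rewrite /scale scalerDr. Qed.

Let scaleDl (x : realified X) : {morph scale^~ x : k l / k + l}.
Proof. by move=> k l; rewrite /scale rmorphD scalerDl. Qed.

HB.instance Definition _ := GRing.Zmodule_isLmodule.Build R (realified X)
  scaleA scale1 scaleDr scaleDl.

End realified_lmodule.

(** The complexification g x - i g (i x) of a real functional g dominated by the
    norm is dominated by the norm as well: rotating x makes its value real,
    hence equal to the value of g. *)
Lemma norming_functional (R : realType) (X : normedModType R[i]) (v : X) :
  exists f : X -> R[i]^o, [/\ linear f,
    forall x, rnorm (f x) <= rnorm x & rnorm (f v) = rnorm v].
Proof.
have normS : @sublinear R (realified X) (@rnorm R X).
  split=> [x y|k x k0]; first exact: rnormD.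
  rewrite -[k *: x]/(k%:C%C *: (x : X)) rnormZ.
  have := rnormC k; rewrite /rnorm => ->; by rewrite gtr0_norm.
have [g [glin gle gv]] := hahn_banach (v : realified X) normS.
have gD (x y : X) : g (x + y) = g x + g y.
  by have := glin 1 x y; rewrite scale1r mul1r.
have gZ (k : R) (x : X) : g (k%:C%C *: x) = k * g x.
  have g0 : g (0 : X) = 0 by have := gD 0 0; rewrite addr0; lra.
  by have := glin k x 0; rewrite g0 !addr0.
have gN (x : X) : g (- x) = - g x.
  by have := gZ (-1) x; rewrite rmorphN1 scaleN1r mulN1r.
pose f (x : X) : R[i]^o := (g x -i* g ('i%C *: x))%C.
have fE (x : X) (k : R[i]) : f (k *: x) = k * f x.
  case: k => a b; rewrite /f.
  have -> : (a +i* b)%C = a%:C%C + b%:C%C * 'i%C by simpc.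
  rewrite scalerA (mulrC 'i%C) mulrDl -mulrA -expr2 sqr_i mulrN1 !scalerDl.
  rewrite -!scalerA scaleNr !gD gN !gZ.
  by apply/eqP; rewrite eq_complex /=; apply/andP; split; apply/eqP; ring.
have fD (x y : X) : f (x + y) = f x + f y.
  by rewrite /f scalerDr !gD opprD.
have fle (x : X) : rnorm (f x) <= rnorm x.
  have [u u1 fxE] := polar (f x).
  have u0 : u != 0 by rewrite -normr_eq0 u1 oner_eq0.
  have : f (u^-1 *: x) = `|f x| by rewrite fE {1}fxE mulrCA mulVf // mulr1.
  move=> /(congr1 (@complex.Re R)) e.
  have <- : g (u^-1 *: x) = rnorm (f x) by exact: e.
  apply: le_trans (gle _) _.
  by rewrite rnormZ normfV u1 invr1 /= mul1r.
exists f; split=> [k x y||]; [by rewrite fD fE|exact: fle|].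
apply/eqP; rewrite eq_le fle /= -gv.
apply: le_trans (ler_norm _) _; rewrite -lecR rnormE.
exact: le_trans (normc_ge_Re (f v)).
Qed.

(** * Derivatives of a Moebius map composed with a functional *)

Lemma near_differentiable (K : numFieldType) (V W : normedModType K)
    (f g : V -> W) (x : V) : (\forall y \near x, f y = g y) ->
  differentiable g x -> differentiable f x /\ 'd f x = 'd g x :> (V -> W).
Proof.
move=> fg dg; have [gc gE] := (diff_locallyP x g).1 dg.
have fE : f \o shift x = cst (f x) + 'd g x +o_ 0 id.
  apply/eqaddoP => e e0; move/eqaddoP: gE => /(_ e e0).
  have : \forall h \near 0, f (h + x) = g (h + x).
    by move: fg; rewrite (near_shift 0 x); apply: filterS => h /=; rewrite subr0.
  apply: filterS2 => h fgh.
  by rewrite /= !fctE /= fgh (nbhs_singleton fg).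
have dE := diff_unique gc fE; split; last exact: dE.
by apply/diff_locallyP; rewrite dE.
Qed.

Section extremal_map.
Variables (R : realType) (X Y : normedModType R[i]) (f : X -> R[i]^o) (v : Y).
Hypothesis f_linear : linear f.
Hypothesis f_le : forall x, rnorm (f x) <= rnorm x.

Let fL : {linear X -> R[i]^o} :=
  HB.pack f (GRing.isLinear.Build _ _ _ _ f f_linear).

Lemma bounded_functional_continuous : continuous f.
Proof.
move=> x; apply/cvgrPdist_lt => e e0; near=> y.
have -> : f x - f y = fL (x - y) by rewrite linearB.
apply: le_lt_trans (_ : `|x - y| < e); first by rewrite -!rnormE lecR f_le.
by near: y; exact: cvgr_dist_lt.
Unshelve. all: by end_near. Qed.

Lemma rank1_clin (Z : normedModType R[i]) (w : Z) :
  (fun x : X => f x *: w) \in @clin R X Z.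
Proof.
apply/clinP; split=> [k x y|x].
  by rewrite f_linear scalerDl scalerA.
exact: continuous_comp (@bounded_functional_continuous x)
  (@scalel_continuous _ _ w (f x)).
Qed.

Definition rank1 (Z : normedModType R[i]) (w : Z) : contlin X Z :=
  ContLin (rank1_clin w).

(** The multilinear map (x_1, ..., x_s) |-> f x_1 ... f x_s v. *)
Fixpoint tensor_power (s : nat) : multilin X Y s :=
  if s is s'.+1 then rank1 (tensor_power s') else v.

Lemma eval_diag_tensor_power s z : eval_diag (tensor_power s) z = f z ^+ s *: v.
Proof.
elim: s => [|s IHs] /=; first by rewrite expr0 scale1r.
by rewrite eval_diagZ IHs scalerA exprS.
Qed.

Variable A : R[i].

(** The s-th derivative of x |-> (A - x) / (1 - A x), in the form given by the
    decomposition A^-1 + (A - A^-1) / (1 - A x). *)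
Definition moebius_deriv (s : nat) (x : R[i]) : R[i] :=
  (if s is 0 then A^-1 else 0) +
  (A - A^-1) * s`!%:R * A ^+ s * (1 - A * x)^-1 ^+ s.+1.

Definition moebius_map (x : X) : Y := moebius_deriv 0 (f x) *: v.

Lemma is_diff_moebius_deriv s x : 1 - A * f x != 0 ->
  is_diff x (fun y => moebius_deriv s (f y) : R[i]^o)
    (fun h => moebius_deriv s.+1 (f x) * f h).
Proof.
move=> x0.
have fd y : is_diff y f f.
  have fc : continuous fL := bounded_functional_continuous.
  by apply: DiffDef; [apply: (linear_differentiable y fc)|apply: (diff_lin y fc)].
have ud : is_diff x (fun y => (1 - A * f y)^-1 : R[i]^o)
    (fun h => A * (1 - A * f x)^-1 ^+ 2 * f h).
  have gd : is_diff x (cst (1 : R[i]^o) - A *: f) (0 - A *: f).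
    by exact: is_diffB.
  have [gx gE] := gd.
  apply: DiffDef; first exact: differentiableV.
  rewrite (diffV gx) // gE; apply/funext => h.
  rewrite !fctE /= sub0r.
  by rewrite exprVn /GRing.scale /=; ring.
have wd := is_diffX s ud.
pose c0 : R[i]^o := if s is 0 then A^-1 else 0.
have ad : is_diff x (cst c0) 0 by exact: is_diff_cst.
have zd := is_diffZ ((A - A^-1) * s`!%:R * A ^+ s) wd.
rewrite (_ : (fun y => _) = cst c0 + ((A - A^-1) * s`!%:R * A ^+ s) *:
    ((fun y => (1 - A * f y)^-1 : R[i]^o) ^+ s.+1)); last first.
  by apply/funext => y; rewrite !fctE.
apply: is_diff_eq (is_diffD ad zd) _; apply/funext => h.
rewrite !fctE /GRing.scale /= add0r /moebius_deriv add0r factS natrM !exprS.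
by ring.
Qed.

(** The formula for order s holds on the open unit ball only, which suffices to
    differentiate it there, since derivatives are local. *)
Lemma fderivn_moebius_map s x :
  (forall y, unit_ball y -> 1 - A * f y != 0) -> unit_ball x ->
  fderivn s moebius_map x = moebius_deriv s (f x) *: tensor_power s.
Proof.
move=> A_ball; elim: s x => [//|s IHs] x xB.
pose G y := moebius_deriv s (f y) *: tensor_power s.
have [dk kE] := is_diff_moebius_deriv s (A_ball x xB).
have near_eq : \forall y \near x, fderivn s moebius_map y = G y.
  have : \forall y \near x, unit_ball y.
    exact: cvgr_norm_lt (@cvg_id _ (nbhs x)) _ xB.
  by apply: filterS => y /IHs.
have [dF FE] := near_differentiable near_eq (differentiableZl (tensor_power s) dk).
have dG : 'd G x = (fun h => (moebius_deriv s.+1 (f x) * f h) *: tensor_power s)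
    :> (X -> _).
  rewrite (diffZl (tensor_power s) dk); apply/funext => h.
  exact: (congr1 (fun d => d h *: tensor_power s) kE).
apply/val_inj; rewrite [LHS](etrans (fderivE dF) (etrans FE dG)).
apply/funext => h.
exact: (esym (scalerA (moebius_deriv s.+1 (f x)) (f h) (tensor_power s))).
Qed.

Lemma hompoly_moebius_map s z :
  (forall y, unit_ball y -> 1 - A * f y != 0) -> (0 < s)%N ->
  hompoly moebius_map s z = ((A - A^-1) * (A * f z) ^+ s) *: v.
Proof.
move=> A_ball s0; have f0 : f 0 = 0 by exact: (linear0 fL).
rewrite /hompoly fderivn_moebius_map //; last by rewrite /unit_ball /= normr0.
rewrite eval_diagZ eval_diag_tensor_power !scalerA /moebius_deriv f0.
case: s s0 => // s _; rewrite mulr0 subr0 invr1 expr1n mulr1 add0r exprMn.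
congr (_ *: _); have : (s.+1)`!%:R != 0 :> R[i] by rewrite pnatr_eq0 -lt0n fact_gt0.
by move: (A ^+ s.+1) (f z ^+ s.+1) (A^-1) => x y B h; field.
Qed.

End extremal_map.

(** * The extremal maps *)

Section extremal_majorant.
Variables (R : realType) (X : normedModType R[i]) (n : nat) (f : X -> R[i]^o).
Variable A : R.
Hypothesis n_gt0 : (0 < n)%N.
Hypothesis f_linear : linear f.
Hypothesis f_le : forall x, rnorm (f x) <= rnorm x.
Hypothesis A01 : 0 < A < 1.

Let v : Cn R n := const_mx 1 : 'rV[R[i]]_n.
Let F := moebius_map f v A%:C%C.

Let A_neq0 : A%:C%C != 0 :> R[i].
Proof. by rewrite gt_eqF // ltcR; case/andP: A01. Qed.

Lemma rnorm_const_row (x : R[i]) : rnorm (x *: v) = rnorm (x : R[i]^o).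
Proof.
apply/eqP; rewrite eq_le; apply/andP; split.
  apply: rnorm_row_le => [|j]; first exact: rnorm_ge0.
  by rewrite !mxE mulr1.
have := rnorm_coord_le (x *: v) (Ordinal n_gt0).
by rewrite !mxE mulr1.
Qed.

Lemma norm_unit_ball_lt1 (x : X) : unit_ball x -> rnorm (f x) < 1.
Proof.
move=> xB; apply: le_lt_trans (f_le x) _.
by rewrite -ltcR rnormE.
Qed.

Lemma moebius_denominator (x : X) : unit_ball x -> 1 - A%:C%C * f x != 0.
Proof.
move=> /norm_unit_ball_lt1 x1; rewrite subr_eq0 eq_sym; apply/eqP.
move=> /(congr1 (fun c : R[i] => rnorm (c : R[i]^o))).
have [/ltW A0 A1] := andP A01.
rewrite rnormM rnormC -[1](@rmorph1 _ _ (real_complex R)) rnormC normr1 ger0_norm //.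
by move=> h; have := rnorm_ge0 (f x); nra.
Qed.

Lemma moebiusE (x : R[i]) : 1 - A%:C%C * x != 0 ->
  moebius_deriv A%:C%C 0 x = (A%:C%C - x) / (1 - A%:C%C * x).
Proof.
move=> x0; rewrite /moebius_deriv fact0 expr0 expr1 !mulr1; field.
by rewrite x0 A_neq0.
Qed.

(** |1 - A y|^2 - |A - y|^2 = (1 - A^2) (1 - |y|^2) for real A. *)
Lemma moebius_lt1 (x : X) : unit_ball x ->
  rnorm (moebius_deriv A%:C%C 0 (f x) : R[i]^o) < 1.
Proof.
move=> xB; have x0 := moebius_denominator xB.
rewrite moebiusE // -ltcR rnormE normrM normfV ltr_pdivrMr ?normr_gt0 //.
rewrite mul1r -ltr_sqr ?nnegrE // -subr_gt0 !normCK !rmorphB !rmorphM rmorph1 /=.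
have -> : (A%:C%C : R[i])^*%R = A%:C%C.
  by rewrite conj_Creal //; apply/complex_realP; exists A.
set a : R[i] := A%:C%C; set y : R[i] := f x.
have -> : (1 - a * y) * (1 - a * y^*) - (a - y) * (a - y^*) =
    (1 - a ^+ 2) * (1 - y * y^*).
  by ring.
have /andP[A0 A1] := A01; rewrite -normCK mulr_gt0 //.
  rewrite -rmorphXn /= -(@rmorph1 _ _ (real_complex R)) -rmorphB ltcR.
  by rewrite subr_gt0 expr_lt1 // ltW.
by rewrite subr_gt0 exprn_ilt1 // -(rnormE (y : R[i]^o)) ltcR norm_unit_ball_lt1.
Qed.

Lemma admissible_moebius_map : admissible (A%:C%C *: v) F.
Proof.
have polyB (x : R[i]) : rnorm (x : R[i]^o) < 1 -> closure (@polydisc R n) (x *: v).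
  move=> x1; apply: subset_closure => j /=; rewrite !mxE mulr1.
  by rewrite -(rnormE (x : R[i]^o)) ltcR.
have /andP[A0 A1] := A01.
split.
- by apply: polyB; rewrite rnormC gtr0_norm.
- by move=> z zB; apply: polyB; exact: moebius_lt1.
- move=> z zB; apply: differentiableZl.
  by have [] := is_diff_moebius_deriv f_linear f_le 0 (moebius_denominator zB).
- move=> z zB; apply/cvg_rnormP.
  have z0 := moebius_denominator zB.
  set q : R[i] := A%:C%C * f z in z0.
  have q1 : rnorm (q : R[i]^o) < 1.
    rewrite /q rnormM rnormC gtr0_norm //.
    by have := norm_unit_ball_lt1 zB; have := rnorm_ge0 (f z); nra.
  pose C : R[i] := (A%:C%C - A%:C%C^-1) / (1 - q).
  have e m : rnorm (F z - (A%:C%C *: v + \sum_(1 <= s < m.+1) hompoly F s z)) =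
      rnorm (C : R[i]^o) * rnorm (q : R[i]^o) ^+ m.+1.
    rewrite -rnormX -rnormM -rnorm_const_row.
    have -> : \sum_(1 <= s < m.+1) hompoly F s z =
        ((A%:C%C - A%:C%C^-1) * ((q - q ^+ m.+1) / (1 - q))) *: v.
      elim: m => [|m IHm].
        by rewrite big_geq // expr1 subrr mul0r mulr0 scale0r.
      rewrite big_nat_recr //= IHm hompoly_moebius_map //; last first.
        exact: moebius_denominator.
      rewrite -scalerDl -/q; congr (_ *: _).
      by rewrite -mulrDr; congr (_ * _); rewrite !exprS; field.
    rewrite /F /moebius_map -scalerDl -scalerBl; congr (rnorm (_ *: _)).
    rewrite moebiusE // -/q /C; move: (q ^+ m.+1) => y.
    rewrite (_ : A%:C%C - f z = A%:C%C - q / A%:C%C).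
      by field; rewrite z0 A_neq0.
    by rewrite /q mulrAC divff ?mul1r.
  move: (@cvg_geometric R (rnorm (C : R[i]^o)) (rnorm (q : R[i]^o))).
  rewrite ger0_norm ?rnorm_ge0 // => /(_ q1); rewrite -cvg_shiftS.
  by apply: cvg_trans; apply: near_eq_cvg; apply: nearW => m /=; rewrite e.
- move=> j; have := rnorm_const_row A%:C%C; rewrite -!rnormE => ->.
  by rewrite !mxE mulr1 rnormE.
Qed.

Lemma rnorm_hompoly_moebius_map (z : X) (s : nat) :
  rnorm (hompoly F s.+1 z) = (1 - A ^+ 2) * A ^+ s * rnorm (f z) ^+ s.+1.
Proof.
have /andP[A0 A1] := A01.
rewrite hompoly_moebius_map //; last exact: moebius_denominator.
rewrite rnorm_const_row exprMn exprS.
have -> : (A%:C%C - A%:C%C^-1) * (A%:C%C * A%:C%C ^+ s * f z ^+ s.+1) =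
    - ((1 - A ^+ 2) * A ^+ s)%:C%C * f z ^+ s.+1.
  rewrite rmorphM rmorphB rmorph1 !rmorphXn /=.
  by move: (f z ^+ s.+1) => y; field.
rewrite rnormM rnormN rnormC rnormX ger0_norm // mulr_ge0 ?exprn_ge0 ?(ltW A0) //.
by rewrite subr_ge0 expr_le1 // ltW.
Qed.

(** The inner sums are (1 + A) (r^N - (A r)^N), so that the majorant is the sum
    L of geometric series, and L - 1 / (1 - r) has the sign of
    r (1 + 2 A) - 1.  Partial sums up to m fall short of L by at most C r^m,
    hence some of them already exceed 1 / (1 - r). *)
Lemma majorant_moebius_map_gt (z : X) : rnorm (f z) = rnorm z ->
  rnorm z < 1 -> 1 < rnorm z * (1 + 2 * A) ->
  ((1 / (1 - rnorm z))%:E < majorant (A%:C%C *: v) F z)%E.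
Proof.
move=> fz; set r := rnorm z => r1 rA; have /andP[A0 A1] := A01.
have r0 : 0 <= r := rnorm_ge0 z.
pose L := A / (1 - r) + (1 + A) * (r / (1 - r) - A * r / (1 - A * r)).
pose C := (1 + 2 * A) * r / (1 - r).
have Ar1 : A * r < 1 by nra.
have [d1 d2] : 1 - r != 0 /\ 1 - A * r != 0 by split; lra.
have LgtP : 0 < L - 1 / (1 - r).
  rewrite (_ : L - 1 / (1 - r) =
      (1 - A) * (r * (1 + 2 * A) - 1) / ((1 - r) * (1 - A * r))).
    by rewrite divr_gt0 ?mulr_gt0 //; lra.
  by rewrite /L; field; rewrite d1 d2.
have [m hm] : exists m, C * r ^+ m < L - 1 / (1 - r).
  have /cvgr0Pnorm_lt/(_ _ LgtP) : geometric C r @ \oo --> 0.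
    by apply: cvg_geometric; rewrite ger0_norm.
  move=> [m _ hm]; exists m; apply: le_lt_trans (ler_norm _) (hm m _).
  exact: leqnn.
have inner N : \sum_(1 <= k < N.+1) r ^+ k.-1 * rnorm (hompoly F (N - k).+1 z) =
    (1 + A) * (r ^+ N - (A * r) ^+ N).
  transitivity (\sum_(1 <= k < N.+1) (1 - A ^+ 2) * r ^+ N * A ^+ (N - k)).
    rewrite big_nat_cond [RHS]big_nat_cond; apply: eq_bigr => k /andP[/andP[k1 kN] _].
    rewrite rnorm_hompoly_moebius_map fz -/r.
    have kN' : N = (k.-1 + (N - k).+1)%N by lia.
    by rewrite [X in _ = _ * r ^+ X * _]kN' exprD; ring.
  have := subrXX A 1 N; rewrite expr1n => AN.
  rewrite -mulr_sumr big_add1 /= big_mkord exprMn.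
  have -> : \sum_(k < N) A ^+ (N - k.+1) = \sum_(k < N) A ^+ (N.-1 - k) * 1 ^+ k.
    by apply: eq_bigr => k _; rewrite expr1n mulr1 subnS -subn1 subnAC subn1.
  move: AN; set S := \sum_(k < N) _ => AN.
  rewrite (_ : A ^+ N = 1 + (A - 1) * S); last by rewrite -AN; ring.
  by ring.
have geo (q : R) : 1 - q != 0 -> forall k,
    \sum_(1 <= N < k.+1) q ^+ N = (q - q ^+ k.+1) / (1 - q).
  move=> q1 k; rewrite -[LHS](mulfK q1); congr (_ / _).
  elim: k => [|k IHk]; first by rewrite big_geq // mul0r expr1 subrr.
  by rewrite big_nat_recr //= mulrDl IHk !exprS; ring.
rewrite /majorant rnorm_const_row rnormC gtr0_norm // -/r.
apply: (@lt_le_trans _ _ ((\sum_(0 <= k < m.+1) A * r ^+ k)%:E +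
    (\sum_(1 <= N < m.+1) (1 + A) * (r ^+ N - (A * r) ^+ N))%:E)%E).
  rewrite -EFinD lte_fin -!mulr_sumr sumrB !geo // big_ltn // geo // expr0.
  have p0 : 0 <= (A * r) ^+ m.+1 / (1 - A * r).
    by rewrite divr_ge0 ?exprn_ge0 ?mulr_ge0 //; lra.
  rewrite -subr_gt0; move: p0; set p := (A * r) ^+ m.+1 => p0.
  rewrite exprS (_ : _ - 1 / _ =
      (L - 1 / (1 - r) - C * r ^+ m) + (1 + A) * (p / (1 - A * r))).
    by rewrite ltr_wpDr ?subr_gt0 // mulr_ge0 //; lra.
  by rewrite /L /C; field; rewrite d1 d2.
apply: leeD; rewrite -sumEFin.
  apply: nneseries_lim_ge => k _ _.
  by rewrite lee_fin mulr_ge0 ?exprn_ge0 // ltW.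
under eq_bigr do rewrite -inner.
apply: nneseries_lim_ge => N _ _; rewrite lee_fin sumr_ge0 // => k _.
by rewrite mulr_ge0 ?exprn_ge0 ?rnorm_ge0.
Qed.

End extremal_majorant.

Theorem theorem2p3 (R : realType) (X : completeNormedModType R[i])
    (hX : exists x : X, x != 0) (n : nat) (hn : (1 <= n)%N) :
  (forall (a : Cn R n) (F : X -> Cn R n), admissible a F ->
     forall z : X, unit_ball z -> rnorm z <= 1 / 3%:R ->
       (majorant a F z <= (1 / (1 - rnorm z))%:E)%E) /\
  (forall R' : R, 1 / 3%:R < R' < 1 ->
     exists (a : Cn R n) (F : X -> Cn R n), admissible a F /\
       exists z : X, [/\ unit_ball z, rnorm z <= R' &
         ~ (majorant a F z <= (1 / (1 - rnorm z))%:E)%E]).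

Proof.
split=> [a F aF z _ z3|R' /andP[R3 R1]]; first exact: majorant_admissible_le.
have [x x0] := hX; have R0 : 0 < R' by apply: lt_trans R3; lra.
pose z := (R'%:C%C / `|x|) *: x.
have zR : rnorm z = R'.
  have nx0 : `|x| != 0 by rewrite normr_eq0.
  apply: (@complexI R); rewrite rnormE normrZ normf_div normr_id divfK //.
  by rewrite -(rnormE (_ : R[i]^o)) rnormC gtr0_norm.
have [f [f_linear f_le fz]] := norming_functional z.
(* This value of A makes r (1 + 2 A) = (1 + 3 r) / 2 for r = R'. *)
pose A := (1 + R') / (4 * R').
have A01 : 0 < A < 1.
  rewrite divr_gt0 ?mulr_gt0 //=; last by lra.
  by rewrite ltr_pdivrMr ?mulr_gt0 //; lra.
exists (A%:C%C *: (const_mx 1 : 'rV[R[i]]_n) : Cn R n).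
exists (moebius_map f (const_mx 1 : 'rV[R[i]]_n) A%:C%C : X -> Cn R n).
split; first exact: admissible_moebius_map.
exists z; split; first by rewrite /unit_ball /= -rnormE zR ltcR.
  by rewrite zR.
apply/negP; rewrite -ltNge; apply: majorant_moebius_map_gt => //; rewrite zR //.
have R'0 : R' != 0 by lra.
rewrite (_ : R' * (1 + 2 * A) = (1 + 3 * R') / 2); first by lra.
by rewrite /A; field.
Qed.
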